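(* Let $R$ be a multiplicative hyperring and let $I$ be a proper strong $\mathbf{C}$-hyperideal of $R$. Then the following are equivalent: (i) $I$ is a 2-absorbing $J$-prime hyperideal of $R$. (ii) For all $a,b\in R$ and every hyperideal $H$ of $R$, if $a\circ b\circ H\subseteq I$, then $a\circ b\subseteq I$ or $a\circ H\subseteq J(R)$ or $b\circ H\subseteq J(R)$. (iii) For all $a\in R$ and all hyperideals $H,T$ of $R$, if $a\circ H\circ T\subseteq I$, then $a\circ H\subseteq I$ or $a\circ T\subseteq J(R)$ or $H\circ T\subseteq J(R)$. (iv) For all hyperideals $K,H,T$ of $R$, if $K\circ H\circ T\subseteq I$, then $K\circ H\subseteq I$ or $K\circ T\subseteq J(R)$ or $H\circ T\subseteq J(R)$.
   Context: A multiplicative hyperring is a nonempty set $R$ with an operation $+$ and a hyperoperation $\circ: R\times R\to P^*(R)$ (where $P^*(R)$ is the set of nonempty subsets of $R$) such that: $(R,+)$ is an abelian group; $\circ$ is associative; $a\circ(b+c)\subseteq a\circ b+a\circ c$ and $(b+c)\circ a\subseteq b\circ a+c\circ a$; and $a\circ(-b)=(-a)\circ b=-(a\circ b)$ for all $a,b,c\in R$. For nonempty subsets $A,B\subseteq R$, $A\circ B=\bigcup_{x\in A,\,y\in B}x\circ y$, and $A\circ r=A\circ\{r\}$. Standing assumptions: $R$ is commutative with an identity $1$, meaning $a\in a\circ 1$ for all $a\in R$. A hyperideal of $R$ is a nonempty subset $I\subseteq R$ with $a-b\in I$ for $a,b\in I$ and $r\circ x\subseteq I$ for $x\in I$, $r\in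 R$. Let $\mathbf{C}=\{r_1\circ r_2\circ\cdots\circ r_n : r_i\in R,\ n\in\mathbb{N}\}$; a hyperideal $I$ is a $\mathbf{C}$-hyperideal if for every $A\in\mathbf{C}$, $A\cap I\neq\varnothing$ implies $A\subseteq I$. Standing assumption: all hyperideals are $\mathbf{C}$-hyperideals. A hyperideal $I$ is a strong $\mathbf{C}$-hyperideal if for every $E\in\mathfrak{U}$, $E\cap I\neq\varnothing$ implies $E\subseteq I$, where $\mathfrak{U}=\{\sum_{i=1}^n A_i : A_i\in\mathbf{C},\ n\in\mathbb{N}\}$ (sums of subsets being elementwise). A proper hyperideal $M$ is maximal if every hyperideal $N$ with $M\subsetneq N\subseteq R$ equals $R$; the Jacobson radical $J(R)$ is the intersection of all maximal hyperideals of $R$. A proper hyperideal $I$ is 2-absorbing $J$-prime if for all $x,y,z\in R$, $x\circ y\circ z\subseteq I$ implies $x\circ y\subseteq I$ or $x\circ z\subseteq J(R)$ or $y\circ z\subseteq J(R)$. *)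

(* Defs.v *)
From HB Require Import structures.
From mathcomp Require Import all_boot all_order all_algebra.
From mathcomp Require Import boolp classical_sets.

Set Implicit Arguments.
Unset Strict Implicit.
Unset Printing Implicit Defensive.

Import GRing.Theory.
Local Open Scope classical_set_scope.
Local Open Scope ring_scope.

Reserved Notation "a <o> b" (at level 40, left associativity).
Reserved Notation "A <O> B" (at level 40, left associativity).

Definition set_opp (V : zmodType) (A : set V) : set V := [set - x | x in A].

Definition set_add (V : zmodType) (A B : set V) : set V :=
  [set x + y | x in A & y in B].

Definition hyper_lift (T : Type) (op : T -> T -> set T) (A B : set T) : set T :=
  \bigcup_(x in A) \bigcup_(y in B) op x y.

HB.mixin Record isMultHyperring R of GRing.Zmodule R := {
  hmul : R -> R -> set R;
  hmul_nonempty : forall a b, hmul a b !=set0;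
  hmulA : forall a b c,
    hyper_lift hmul [set a] (hmul b c) = hyper_lift hmul (hmul a b) [set c];
  hmulDr : forall a b c, hmul a (b + c) `<=` set_add (hmul a b) (hmul a c);
  hmulDl : forall a b c, hmul (b + c) a `<=` set_add (hmul b a) (hmul c a);
  hmulrN : forall a b, hmul a (- b) = set_opp (hmul a b);
  hmulNr : forall a b, hmul (- a) b = set_opp (hmul a b)
}.

#[short(type="multHyperringType")]
HB.structure Definition MultHyperring :=
  { R of isMultHyperring R & GRing.Zmodule R }.

HB.mixin Record MultHyperring_isComUnital R of MultHyperring R := {
  hone : R;
  hmulC : forall a b : R, hmul a b = hmul b a;
  hmul1_mem : forall a : R, hmul a hone a
}.

#[short(type="comMultHyperringType")]
HB.structure Definition ComMultHyperring :=
  { R of MultHyperring_isComUnital R & MultHyperring R }.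

Notation "a <o> b" := (hmul a b) : ring_scope.
Notation "A <O> B" := (hyper_lift hmul A B) : ring_scope.

(* The product r <o> s_1 <o> ... <o> s_n, which is [set r] when s is empty. *)
Definition hprod (R : multHyperringType) (r : R) (s : seq R) : set R :=
  foldl (fun A x => A <O> [set x]) [set r] s.

Definition C_class (R : multHyperringType) : set (set R) :=
  [set A | exists r s, A = hprod r s].

Arguments C_class R : clear implicits.

Definition U_class (R : multHyperringType) : set (set R) :=
  [set E | exists (n : nat) (A : 'I_n.+1 -> set R),
     (forall i, C_class R (A i)) /\
     E = [set \sum_(i < n.+1) f i | f in [set f | forall i, A i (f i)]]].

Arguments U_class R : clear implicits.

Record hyperideal (R : multHyperringType) (I : set R) : Prop := {
  hyperideal_nonempty : I !=set0;
  hyperideal_sub : forall a b, I a -> I b -> I (a - b);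
  hyperideal_hmul : forall r x, I x -> r <o> x `<=` I
}.

Definition C_hyperideal (R : multHyperringType) (I : set R) : Prop :=
  hyperideal I /\ (forall A, C_class R A -> A `&` I !=set0 -> A `<=` I).

Definition strong_C_hyperideal (R : multHyperringType) (I : set R) : Prop :=
  hyperideal I /\ (forall E, U_class R E -> E `&` I !=set0 -> E `<=` I).

(* By convention all hyperideals under consideration are C-hyperideals, so the
   notions below range over C-hyperideals. When every hyperideal of R happens to
   be a C-hyperideal, they are the notions for arbitrary hyperideals. *)

Definition maximal_hyperideal (R : multHyperringType) (M : set R) : Prop :=
  [/\ C_hyperideal M, M <> setT &
      forall N, C_hyperideal N -> M `<` N -> N = setT].

(* This is setT when R has no maximal hyperideal. *)
Definition jacobson (R : multHyperringType) : set R :=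
  \bigcap_(M in @maximal_hyperideal R) M.

Arguments jacobson R : clear implicits.

Definition two_absorbing_J_prime (R : multHyperringType) (I : set R) : Prop :=
  [/\ C_hyperideal I, I <> setT &
      forall x y z : R, (x <o> y) <O> [set z] `<=` I ->
        [\/ x <o> y `<=` I, x <o> z `<=` jacobson R | y <o> z `<=` jacobson R]].

(* Main.v *)
Require Import Defs.
From HB Require Import structures.
From mathcomp Require Import all_boot all_order all_algebra.
From mathcomp Require Import boolp classical_sets.

Import GRing.Theory.

Local Open Scope classical_set_scope.
Local Open Scope ring_scope.

(** The proof rests on the colon sets (P : B), made of the x with
    x <o> b contained in P for every b in B. They turn products into
    inclusions: A <O> B is contained in P exactly when A is contained in
    (P : B) (lemma hyper_lift_subE).

    Going from elements to hyperideals, one variable at a time, uses that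
    (P : B) is closed under differences whenever P is (diff_closed_colon).
    For instance, when (x <o> y) <O> H lies in I but x <o> y does not,
    2-absorption puts every h in H in (J(R) : x) or in (J(R) : y). A set closed
    under differences is never covered by two such sets without lying inside
    one of them (diff_closed_cover), so H lies entirely in (J(R) : x) or
    entirely in (J(R) : y). Every step that replaces an element by a hyperideal
    has this shape (hyper_lift_sub_or).

    Going back from hyperideals to elements x, y, z, one needs hyperideals K, H
    and T containing them with K <O> H <O> T inside I. The C-hyperideals
    generated by x, y and z work: when I is a C-hyperideal so is every (I : B)
    (C_hyperideal_colon), hence (I : B) contains the C-hyperideal generated by
    x as soon as it contains x. Each of the three factors of the product is
    enlarged in turn by this remark. *)

Definition diff_closed {V : zmodType} (A : set V) : Prop :=
  forall a b, A a -> A b -> A (a - b).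

(** The argument that a group is not the union of two proper subgroups: for u
    in H outside A and v in H outside B, the difference u - v can lie neither
    in A, which contains v, nor in B, which contains u. *)
Lemma diff_closed_cover {V : zmodType} {H A B : set V} :
  diff_closed H -> diff_closed A -> diff_closed B ->
  (forall h, H h -> A h \/ B h) -> H `<=` A \/ H `<=` B.
Proof.
move=> dH dA dB cov; apply: contrapT => /not_orP[].
move=> /existsNP[u /not_implyP[Hu nAu]] /existsNP[v /not_implyP[Hv nBv]].
have [//|Bu] := cov u Hu; have [Av|//] := cov v Hv.
have [Auv|Buv] := cov _ (dH _ _ Hu Hv).
- apply: nAu; have A0 : A 0 by rewrite -(subrr v); exact: dA.
  have := dA _ _ Auv (dA _ _ A0 Av).
  by rewrite sub0r opprK subrK.
- by apply: nBv; have := dB _ _ Bu Buv; rewrite subKr.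
Qed.

Lemma hyper_lift_sub {R : multHyperringType} (A B P : set R) :
  A <O> B `<=` P <-> (forall a b, A a -> B b -> a <o> b `<=` P).
Proof.
split=> [sP a b Aa Bb c abc | sP c [a Aa [b Bb abc]]].
- by apply: sP; exists a => //; exists b.
- exact: (sP a b).
Qed.

Lemma hyper_lift11 {R : multHyperringType} (a b : R) :
  [set a] <O> [set b] = a <o> b.
Proof. by rewrite /hyper_lift !bigcup_set1. Qed.

Lemma hyper_liftA {R : multHyperringType} (A B C : set R) :
  A <O> (B <O> C) = A <O> B <O> C.
Proof.
apply/seteqP; split=> u.
- move=> [a Aa [v [b Bb [c Cc bcv]] avu]].
  have : ([set a] <O> (b <o> c)) u by exists a => //; exists v.
  rewrite hmulA => -[w abw [c' -> wcu]].
  by exists w; [exists a => //; exists b | exists c].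
- move=> [w [a Aa [b Bb abw]] [c Cc wcu]].
  have : ((a <o> b) <O> [set c]) u by exists w => //; exists c.
  rewrite -hmulA => -[a' -> [v bcv avu]].
  by exists a => //; exists v => //; exists b => //; exists c.
Qed.

Lemma hyper_liftC {R : comMultHyperringType} (A B : set R) :
  A <O> B = B <O> A.
Proof.
by apply/seteqP; split=> u [a Aa [b Bb abu]]; exists b => //; exists a => //;
   rewrite hmulC.
Qed.

Lemma hyper_liftCA {R : comMultHyperringType} (A B C : set R) :
  A <O> (B <O> C) = B <O> (A <O> C).
Proof. by rewrite !hyper_liftA (hyper_liftC A). Qed.

Definition colon {R : multHyperringType} (P B : set R) : set R :=
  [set x | forall b, B b -> x <o> b `<=` P].

Lemma hyper_lift_subE {R : multHyperringType} (A B P : set R) :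
  A <O> B `<=` P <-> A `<=` colon P B.
Proof.
rewrite hyper_lift_sub; split=> [sP a Aa b Bb | sP a b Aa Bb].
- exact: sP.
- exact: sP.
Qed.

Lemma colon1E {R : multHyperringType} (P B : set R) (x : R) :
  colon P B x <-> [set x] <O> B `<=` P.
Proof. by rewrite hyper_lift_subE sub1set inE. Qed.

Lemma diff_closed_colon {R : multHyperringType} {P B : set R} :
  diff_closed P -> diff_closed (colon P B).
Proof.
move=> dP x y xP yP b Bb c /hmulDl[u xbu [v]].
rewrite hmulNr => -[w ybw <-] <-.
by apply: dP; [exact: (xP b) | exact: (yP b)].
Qed.

(** The passage from the elements of a hyperideal H to H itself: the hypothesis
    covers H by the colons (P : B) and (Q : C). *)
Lemma hyper_lift_sub_or {R : multHyperringType} {H B C P Q : set R} :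
  hyperideal H -> diff_closed P -> diff_closed Q ->
  (forall h, H h -> [set h] <O> B `<=` P \/ [set h] <O> C `<=` Q) ->
  H <O> B `<=` P \/ H <O> C `<=` Q.
Proof.
move=> hH dP dQ cov; rewrite !hyper_lift_subE; apply: diff_closed_cover.
- exact: (hyperideal_sub hH).
- exact: diff_closed_colon.
- exact: diff_closed_colon.
- by move=> h /cov; rewrite -!colon1E.
Qed.

(** If a product A meets (P : B) at x then, for b in B, the product
    A <O> [set b] meets P, as x <o> b is a nonempty part of both; so it is
    contained in P. *)
Lemma C_hyperideal_colon {R : comMultHyperringType} (P B : set R) :
  C_hyperideal P -> C_hyperideal (colon P B).
Proof.
move=> [hP CP]; split; first split.
- have [p Pp] := hyperideal_nonempty hP.
  by exists p => b _; rewrite hmulC; exact: (hyperideal_hmul hP).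
- exact: diff_closed_colon (hyperideal_sub hP).
- move=> r x xP; apply/hyper_lift_subE; rewrite -hyper_lift11 -hyper_liftA.
  apply/hyper_lift_sub => _ u -> [_ -> [b Bb xbu]].
  by apply: (hyperideal_hmul hP); exact: (xP b).
- move=> _ [r [s ->]] [x [Ax xP]] y Ay b Bb.
  have [u xbu] := hmul_nonempty x b.
  have CAb : C_class R (hprod r s <O> [set b]).
    by exists r, (rcons s b); rewrite /hprod foldl_rcons.
  apply: subset_trans (CP _ CAb _).
  + by move=> c ybc; exists y => //; exists b.
  + by exists u; split; [exists x => //; exists b | exact: (xP b)].
Qed.

Definition C_span {R : multHyperringType} (x : R) : set R :=
  [set h | forall N, C_hyperideal N -> N x -> N h].

Lemma C_span_gen {R : multHyperringType} (x : R) : C_span x x.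
Proof. by []. Qed.

Lemma C_hyperideal_span {R : multHyperringType} (x : R) :
  C_hyperideal (C_span x).
Proof.
split; first split.
- by exists x.
- by move=> a b xa xb N CN Nx; apply: (hyperideal_sub CN.1);
     [exact: xa | exact: xb].
- move=> r a xa c rac N CN Nx.
  by apply: (hyperideal_hmul CN.1 _ rac); exact: xa.
- move=> A CA [a [Aa xa]] c Ac N CN Nx.
  by apply: (CN.2 A CA _ c Ac); exists a; split=> //; exact: xa.
Qed.

(** The colon (P : B) is a C-hyperideal, so it contains the span of x as soon as
    it contains x. *)
Lemma C_span_hyper_lift_sub {R : comMultHyperringType} {P B : set R} {x : R} :
  C_hyperideal P -> [set x] <O> B `<=` P -> C_span x <O> B `<=` P.
Proof.
move=> CP /colon1E xB; apply/hyper_lift_subE => h; apply=> //.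
exact: C_hyperideal_colon.
Qed.

Lemma diff_closed_jacobson {R : multHyperringType} : diff_closed (jacobson R).
Proof.
move=> a b Ja Jb M maxM; have [[hM _] _ _] := maxM.
by apply: (hyperideal_sub hM); [exact: Ja | exact: Jb].
Qed.

Lemma strong_C_hyperidealW {R : multHyperringType} {I : set R} :
  strong_C_hyperideal I -> C_hyperideal I.
Proof.
move=> [hI UI]; split=> // A CA; apply: UI.
exists 0, (fun=> A); split=> //; apply/seteqP; split=> a.
- by move=> Aa; exists (fun=> a) => //; rewrite big_ord1.
- by move=> [f Af <-]; rewrite big_ord1; exact: Af.
Qed.

Theorem theorem5p10 (R : comMultHyperringType) (I : set R)
    (I_strong : strong_C_hyperideal I) (I_proper : I <> setT) :
  [<-> two_absorbing_J_prime I;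
       (forall (a b : R) (H : set R), C_hyperideal H ->
          (a <o> b) <O> H `<=` I ->
          [\/ a <o> b `<=` I, [set a] <O> H `<=` jacobson R
            | [set b] <O> H `<=` jacobson R]);
       (forall (a : R) (H T : set R), C_hyperideal H -> C_hyperideal T ->
          [set a] <O> H <O> T `<=` I ->
          [\/ [set a] <O> H `<=` I, [set a] <O> T `<=` jacobson R
            | H <O> T `<=` jacobson R]);
       (forall K H T : set R, C_hyperideal K -> C_hyperideal H ->
          C_hyperideal T -> K <O> H <O> T `<=` I ->
          [\/ K <O> H `<=` I, K <O> T `<=` jacobson R
            | H <O> T `<=` jacobson R])].
Proof.
have CI := strong_C_hyperidealW I_strong.
have dI : diff_closed I := hyperideal_sub CI.1.
have dJ := @diff_closed_jacobson R.
tfae.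
- move=> [_ _ absI] a b H [hH _] abHI.
  have [|nabI] := pselect (a <o> b `<=` I); first exact: Or31.
  rewrite ![[set _] <O> H]hyper_liftC.
  suff [] : H <O> [set a] `<=` jacobson R \/ H <O> [set b] `<=` jacobson R.
  + exact: Or32.
  + exact: Or33.
  apply: (hyper_lift_sub_or hH dJ dJ) => h Hh.
  rewrite !hyper_lift11 ![h <o> _]hmulC.
  have /absI[//| |] : (a <o> b) <O> [set h] `<=` I; [|by left|by right].
  apply: subset_trans abHI; apply/hyper_lift_sub => u _ abu -> v uhv.
  by exists u => //; exists h.
- move=> absI a H T [hH _] CT aHTI.
  have [|naTJ] := pselect ([set a] <O> T `<=` jacobson R); first exact: Or32.
  rewrite [[set a] <O> H]hyper_liftC.
  suff [] : H <O> [set a] `<=` I \/ H <O> T `<=` jacobson R.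
  + exact: Or31.
  + exact: Or33.
  apply: (hyper_lift_sub_or hH dI dJ) => h Hh; rewrite hyper_lift11 hmulC.
  have /absI[//| |//|] : (a <o> h) <O> T `<=` I; [|by left|by right].
  apply: subset_trans aHTI; apply/hyper_lift_sub => u t ahu Tt v utv.
  by exists u; [exists a => //; exists h | exists t].
- move=> absI K H T [hK _] CH CT KHTI.
  have [|nHTJ] := pselect (H <O> T `<=` jacobson R); first exact: Or33.
  suff [] : K <O> H `<=` I \/ K <O> T `<=` jacobson R.
  + exact: Or31.
  + exact: Or32.
  apply: (hyper_lift_sub_or hK dI dJ) => k Kk.
  have /absI[//|//| | |//] : [set k] <O> H <O> T `<=` I; [|by left|by right].
  rewrite -hyper_liftA; apply/colon1E; move: k Kk; apply/hyper_lift_subE.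
  by rewrite hyper_liftA.
- move=> absI; split=> // x y z xyzI.
  have : C_span x <O> C_span y <O> C_span z `<=` I.
    (* each rewrite brings to the front the next span to be replaced by its
       generator *)
    rewrite -hyper_liftA; apply: (C_span_hyper_lift_sub CI).
    rewrite hyper_liftCA; apply: (C_span_hyper_lift_sub CI).
    rewrite hyper_liftCA hyper_liftA hyper_liftC.
    apply: (C_span_hyper_lift_sub CI).
    by rewrite hyper_liftC hyper_lift11.
  have span_sub A u v : C_span u <O> C_span v `<=` A -> u <o> v `<=` A.
    by move/hyper_lift_sub; apply; exact: C_span_gen.
  case/(absI _ _ _ (C_hyperideal_span x) (C_hyperideal_span y)
    (C_hyperideal_span z)) => /span_sub; [exact: Or31|exact: Or32|exact: Or33].
Qed.
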